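(* Let $R$ be a non-associative ring and let $\sigma,\delta:R\to R$ be additive maps with $\sigma(1)=1$ and $\delta(1)=0$. Suppose that $R$ is $\sigma$-$\delta$-simple. If $\sigma$ is a fixed point homomorphism and $\delta$ is a $\sigma$-kernel derivation, then $Z(R)_\delta^\sigma$ is a field.
   Context: A non-associative ring is an additive abelian group with a (not necessarily associative) multiplication that is left and right distributive, and with a multiplicative identity $1\neq 0$. Ideals are two-sided. The center $Z(R)$ is the set of elements $r\in R$ that commute with all elements of $R$ and satisfy $(r,s,t)=(s,r,t)=(s,t,r)=0$ for all $s,t\in R$, where $(r,s,t)=(rs)t-r(st)$. For a subset $T\subseteq R$, $T_\delta^\sigma=\{a\in T\mid \sigma(a)=a,\ \delta(a)=0\}$. One says that $\sigma$ is a fixed point homomorphism and $\delta$ is a $\sigma$-kernel derivation if $\sigma(1)=1$, $\delta(1)=0$, and either both maps are right $R_\delta^\sigma$-linear ($\sigma(ra)=\sigma(r)a$, $\delta(ra)=\delta(r)a$ for $r\in R$, $a\in R_\delta^\sigma$) or both are left $R_\delta^\sigma$-linear ($\sigma(ar)=a\sigma(r)$, $\delta(ar)=a\delta(r)$). An ideal $I$ of $R$ is $\sigma$-$\delta$-invariant if $\sigma(I)\subseteq I$ and $\delta(I)\subseteq I$. $R$ is $\sigma$-$\delta$-simple if $\{0\}$ and $R$ are the only $\sigma$-$\delta$-invariant ideals of $R$. *)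

(* Defs.v *)
From HB Require Import structures.
From mathcomp Require Import all_boot all_order all_algebra.
From mathcomp Require Import boolp classical_sets.

Set Implicit Arguments.
Unset Strict Implicit.
Unset Printing Implicit Defensive.

Import GRing.Theory.

Local Open Scope ring_scope.
Local Open Scope classical_set_scope.
(* Opened last: on a non-associative ring, 1 and * are those of the unital
   magma, while 0, + and - are those of the additive group. *)
Local Open Scope group_scope.

HB.mixin Record Zmodule_UMagma_isNonAssocRing R
    of GRing.Zmodule R & UMagma R := {
  namulDl : left_distributive (@monoid.mul R) (@GRing.add R);
  namulDr : right_distributive (@monoid.mul R) (@GRing.add R);
  naone_neq0 : (1 : R) != 0
}.

#[short(type="nonAssocRingType")]
HB.structure Definition NonAssocRing :=
  {R of GRing.Zmodule R & UMagma R & Zmodule_UMagma_isNonAssocRing R}.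

Section NonAssocRing.

Variable R : nonAssocRingType.

Definition associator (r s t : R) : R := (r * s * t)%g - (r * (s * t))%g.

Definition center : set R := [set r |
  (forall s : R, r * s = s * r) /\
  (forall s t : R, [/\ associator r s t = 0,
                       associator s r t = 0 &
                       associator s t r = 0])].

Definition ideal (I : set R) : Prop :=
  [/\ I 0,
      forall x y, I x -> I y -> I (x - y),
      forall r x, I x -> I (r * x) &
      forall r x, I x -> I (x * r)].

Definition fixed_kernel (sigma delta : R -> R) (T : set R) : set R :=
  [set a | [/\ T a, sigma a = a & delta a = 0]].

Definition right_linear_over (A : set R) (f : R -> R) : Prop :=
  forall r a, A a -> f (r * a) = f r * a.

Definition left_linear_over (A : set R) (f : R -> R) : Prop :=
  forall r a, A a -> f (a * r) = a * f r.

(* The side of linearity has to be the same for both maps, hence a joint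
   predicate. *)
Definition fixed_point_hom_kernel_derivation (sigma delta : R -> R) : Prop :=
  let A := fixed_kernel sigma delta [set: R] in
  [/\ sigma 1 = 1, delta 1 = 0 &
      (right_linear_over A sigma /\ right_linear_over A delta) \/
      (left_linear_over A sigma /\ left_linear_over A delta)].

Definition invariant_ideal (sigma delta : R -> R) (I : set R) : Prop :=
  [/\ ideal I, sigma @` I `<=` I & delta @` I `<=` I].

Definition sigma_delta_simple (sigma delta : R -> R) : Prop :=
  forall I : set R, invariant_ideal sigma delta I <-> I = [set 0] \/ I = [set: R].

(* S is a field under the operations of R: some field is carried by S, its
   operations and unit being those of R through the inclusion f. *)
Definition is_field (S : set R) : Prop :=
  exists (F : fieldType) (f : {additive F -> R}),
    [/\ injective f,
        range f = S,
        f 1%R = 1 &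
        forall x y : F, f (x * y)%R = f x * f y].

End NonAssocRing.

(* Main.v *)
Require Import Defs.
From HB Require Import structures.
From mathcomp Require Import all_boot all_order all_algebra.
From mathcomp Require Import boolp classical_sets.

(** Write K for the set of central elements fixed by sigma and killed by delta.
    It is closed under subtraction and multiplication, commutative and
    associative because its elements are central, so that only inverses are at
    stake.

    Let a be a nonzero element of K.  Since a is central, the left multiples
    R a form a two-sided ideal ([left_multiples_ideal]).  Linearity of sigma and
    delta over the elements fixed by sigma and killed by delta, on whichever
    side it holds, gives f (r a) = f r a for f = sigma and f = delta, because a
    commutes with everything; hence R a is invariant.  It contains a, so by
    simplicity it is all of R and 1 = b a for some b ([central_unit_of_simple]).

    This b lies in K again, by one cancellation argument.  Multiplication by a
    on the right is injective, with inverse the multiplication by b, and the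
    factor a moves freely through any product.  Hence an identity linear
    in b may be checked after multiplying it by a, where on each side b meets a
    and disappears ([center_inv], [fixed_kernel_inv]). *)

Set Implicit Arguments.
Unset Strict Implicit.
Unset Printing Implicit Defensive.

Import GRing.Theory.

Local Open Scope ring_scope.
Local Open Scope classical_set_scope.
Local Open Scope group_scope.

(** * Subsets of a non-associative ring that are fields *)

Section FieldOfSubset.

Variables (R : nonAssocRingType) (S : set R).
Hypotheses (S1 : S 1) (SB : forall x y, S x -> S y -> S (x - y)).
Hypotheses (SM : forall x y, S x -> S y -> S (x * y)).
Hypothesis SC : forall x y, S x -> S y -> x * y = y * x.
Hypothesis SA : forall x y z, S x -> S y -> S z -> x * (y * z) = x * y * z.
Hypothesis SV : forall x, S x -> x != 0 -> exists2 y, S y & y * x = 1.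

Let inS : pred R := fun x => `[< S x >].

Let inS_zmod_closed : zmod_closed inS.
Proof.
split=> [|x y /asboolP Sx /asboolP Sy]; apply/asboolP; last exact: SB.
by rewrite -(subrr 1); apply: SB.
Qed.

HB.instance Definition _ := GRing.isZmodClosed.Build R inS inS_zmod_closed.

Definition subset_field := {x : R | inS x}.
#[local] Notation F := subset_field.

HB.instance Definition _ := SubChoice.on F.
HB.instance Definition _ := [SubChoice_isSubZmodule of F by <:].

Let valS (x : F) : S (val x). Proof. exact/asboolP/(valP x). Qed.

Let mkF x (Sx : S x) : F := exist _ x (asboolT Sx).

Let mulF (x y : F) : F := mkF (SM (valS x) (valS y)).

Let mulFA : associative mulF.
Proof. by move=> x y z; apply/val_inj/SA; exact: valS. Qed.

Let mulFC : commutative mulF.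
Proof. by move=> x y; apply/val_inj/SC; exact: valS. Qed.

Let mul1F : left_id (mkF S1) mulF.
Proof. by move=> x; apply/val_inj/mul1g. Qed.

Let mulFDl : left_distributive mulF +%R.
Proof. by move=> x y z; apply/val_inj/namulDl. Qed.

Let oneF_neq0 : mkF S1 != 0.
Proof. exact: naone_neq0. Qed.

HB.instance Definition _ :=
  GRing.Zmodule_isComNzRing.Build F mulFA mulFC mul1F mulFDl oneF_neq0.

Let invF_ex (x : F) :
  exists y : F, (x != 0 -> (y * x)%R = 1%R) /\ (x = 0 -> y = 0).
Proof.
case: (eqVneq x 0) => [_|x0]; first by exists 0.
have [y Sy yx1] := SV (valS x) x0.
exists (mkF Sy); split=> [_|xE]; first exact: val_inj.
by rewrite xE eqxx in x0.
Qed.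

Let invF (x : F) : F := projT1 (cid (invF_ex x)).

Let mulVF (x : F) : x != 0 -> (invF x * x)%R = 1%R.
Proof. exact: (projT2 (cid (invF_ex x))).1. Qed.

Let invF0 : invF 0 = 0.
Proof. exact: (projT2 (cid (invF_ex 0))).2. Qed.

HB.instance Definition _ := GRing.ComNzRing_isField.Build F mulVF invF0.

Lemma is_field_of_closed : is_field S.
Proof.
exists (F : fieldType), (val : {additive F -> R}).
split=> //; first exact: val_inj.
apply/seteqP; split=> [_ [x _ <-]|x Sx]; first exact: valS.
by exists (mkF Sx).
Qed.

End FieldOfSubset.

(** * The center of a non-associative ring *)

Section Center.

Variable R : nonAssocRingType.
Implicit Types a b r s t x y z : R.

Lemma namul0r x : 0 * x = 0.
Proof. by apply: (addrI (0 * x)); rewrite -namulDl !addr0. Qed.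

Lemma namulBl x y z : (x - y) * z = (x * z)%g - (y * z)%g.
Proof. by apply/eqP; rewrite eq_sym subr_eq -namulDl subrK. Qed.

Lemma namulBr x y z : x * (y - z) = (x * y)%g - (x * z)%g.
Proof. by apply/eqP; rewrite eq_sym subr_eq -namulDr subrK. Qed.

Lemma centerP r : center r <->
  (forall s, r * s = s * r) /\
  (forall s t, [/\ r * s * t = r * (s * t),
                   s * r * t = s * (r * t) &
                   s * t * r = s * (t * r)]).
Proof.
split=> -[rC rA]; split=> // s t; have [] := rA s t.
  by move=> /subr0_eq ? /subr0_eq ? /subr0_eq.
by move=> e1 e2 e3; rewrite /associator e1 e2 e3 !subrr.
Qed.

Section CentralElement.

Variables (a : R) (aZ : center a).

Lemma center_comm s : a * s = s * a.
Proof. by have [] := aZ. Qed.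

Lemma center_mulA s t : a * s * t = a * (s * t).
Proof. by have [_ aA] := (centerP a).1 aZ; have [] := aA s t. Qed.

Lemma mul_centerA s t : s * a * t = s * (a * t).
Proof. by have [_ aA] := (centerP a).1 aZ; have [] := aA s t. Qed.

Lemma mulA_center s t : s * t * a = s * (t * a).
Proof. by have [_ aA] := (centerP a).1 aZ; have [] := aA s t. Qed.

Lemma mul_centerAC s t : s * t * a = s * a * t.
Proof. by rewrite mulA_center -center_comm mul_centerA. Qed.

Lemma left_multiples_ideal : ideal [set r * a | r in [set: R]].
Proof.
split=> [|_ _ [x _ <-] [y _ <-]|r _ [x _ <-]|r _ [x _ <-]].
- by exists 0; rewrite ?namul0r.
- by exists (x - y); rewrite ?namulBl.
- by exists (r * x); rewrite ?mulA_center.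
- by exists (x * r); rewrite ?mul_centerAC.
Qed.

End CentralElement.

Lemma center1 : center (1 : R).
Proof. by apply/centerP; split=> [s|s t]; rewrite !(mul1g, mulg1). Qed.

Lemma centerB x y : center x -> center y -> center (x - y).
Proof.
move=> xZ yZ; apply/centerP; split=> [s|s t].
  by rewrite namulBl namulBr (center_comm xZ) (center_comm yZ).
rewrite !(namulBl, namulBr); split.
- by rewrite (center_mulA xZ) (center_mulA yZ).
- by rewrite (mul_centerA xZ) (mul_centerA yZ).
- by rewrite (mulA_center xZ) (mulA_center yZ).
Qed.

Lemma centerM x y : center x -> center y -> center (x * y).
Proof.
move=> xZ yZ; apply/centerP; split=> [s|s t].
  by rewrite (center_mulA xZ) (center_comm yZ) -!(mulA_center yZ)
             (center_comm xZ).
split.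
- by rewrite !(center_mulA xZ) (center_mulA yZ).
- by rewrite -(mulA_center yZ) (mul_centerA yZ) (mul_centerA xZ)
             (center_mulA xZ).
- by rewrite -!(mulA_center yZ) (mulA_center xZ).
Qed.

Section CentralUnit.

Variables (a b : R) (aZ : center a) (ba1 : b * a = 1).

Lemma center_unit_mulIr x y : x * a = y * a -> x = y.
Proof.
have bK z : z * a * b = z by rewrite (mul_centerA aZ) (center_comm aZ) ba1 mulg1.
by move=> xaya; rewrite -[x]bK xaya bK.
Qed.

(** Each identity is multiplied by a; bringing a next to b turns both sides
    into the same product without b. *)
Lemma center_inv : center b.
Proof.
have mulKl s : b * s * a = s by rewrite (mul_centerAC aZ) ba1 mul1g.
have mulKr s : s * b * a = s by rewrite (mulA_center aZ) ba1 mulg1.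
apply/centerP; split=> [s|s t]; first by apply: center_unit_mulIr; rewrite mulKl mulKr.
split; apply: center_unit_mulIr.
- by rewrite (mul_centerAC aZ) !mulKl.
- by rewrite (mul_centerAC aZ) mulKr (mulA_center aZ) mulKl.
- by rewrite mulKr (mulA_center aZ) mulKr.
Qed.

End CentralUnit.

End Center.

(** * Central elements fixed by sigma and killed by delta *)

Section FixedKernel.

Variables (R : nonAssocRingType) (sigma delta : {additive R -> R}).
Hypothesis fixed_ker : fixed_point_hom_kernel_derivation sigma delta.
Implicit Types a b r x y : R.

Let K := fixed_kernel sigma delta (@center R).

(** On central elements, left and right linearity say the same thing. *)
Lemma fixed_kernel_linear r a : K a ->
  sigma (r * a) = sigma r * a /\ delta (r * a) = delta r * a.
Proof.
move=> [aZ sa da].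
have aK : fixed_kernel sigma delta [set: R] a by [].
have [_ _ [[sR dR]|[sL dL]]] := fixed_ker; first by rewrite sR ?dR.
by rewrite -!(center_comm aZ) sL ?dL.
Qed.

Lemma fixed_kernel1 : K 1.
Proof. by have [s1 d1 _] := fixed_ker; split=> //; exact: center1. Qed.

Lemma fixed_kernelB x y : K x -> K y -> K (x - y).
Proof.
move=> [xZ sx dx] [yZ sy dy].
split; first exact: centerB.
- by rewrite raddfB sx sy.
- by rewrite raddfB dx dy subrr.
Qed.

Lemma fixed_kernelM x y : K x -> K y -> K (x * y).
Proof.
move=> [xZ sx dx] yK; have [yZ _ _] := yK.
have [sxy dxy] := fixed_kernel_linear x yK.
split; first exact: centerM.
- by rewrite sxy sx.
- by rewrite dxy dx namul0r.
Qed.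

(** The values f b, for f = sigma or delta, are found by cancelling a in
    f b * a = f (b * a) = f 1. *)
Lemma fixed_kernel_inv a b : K a -> b * a = 1 -> K b.
Proof.
move=> aK ba1; have [aZ _ _] := aK; have [_ s1 d1] := fixed_kernel1.
have [sba dba] := fixed_kernel_linear b aK.
split; first exact: center_inv ba1.
- by apply: (center_unit_mulIr aZ ba1); rewrite -sba ba1.
- by apply: (center_unit_mulIr aZ ba1); rewrite -dba ba1 namul0r.
Qed.

(** The left multiples of a form an invariant ideal containing a, hence by
    simplicity the whole ring. *)
Lemma central_unit_of_simple a : sigma_delta_simple sigma delta ->
  K a -> a != 0 -> exists b, b * a = 1.
Proof.
move=> simpleR aK a0; have [aZ _ _] := aK.
pose I := [set r * a | r in [set: R]].
have Iinv : invariant_ideal sigma delta I.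
  split; first exact: left_multiples_ideal.
  - move=> _ [_ [r _ <-] <-].
    by exists (sigma r); rewrite // (fixed_kernel_linear r aK).1.
  - move=> _ [_ [r _ <-] <-].
    by exists (delta r); rewrite // (fixed_kernel_linear r aK).2.
have [I0|IT] := (simpleR I).1 Iinv.
  have : I a by exists 1; rewrite ?mul1g.
  by rewrite I0 => /= aE; rewrite aE eqxx in a0.
have : I 1 by rewrite IT.
by case=> b _ ba1; exists b.
Qed.

End FixedKernel.

Theorem proposition22 (R : nonAssocRingType) (sigma delta : {additive R -> R})
    (sigma1 : sigma 1%g = 1%g) (delta1 : delta 1%g = 0%R)
    (simpleR : sigma_delta_simple sigma delta)
    (fixed_ker : fixed_point_hom_kernel_derivation sigma delta) :
  is_field (fixed_kernel sigma delta (@center R)).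
Proof.
apply: is_field_of_closed.
- exact: fixed_kernel1.
- exact: fixed_kernelB.
- exact: fixed_kernelM.
- by move=> x y [xZ _ _] _; exact: center_comm.
- by move=> x y z [xZ _ _] _ _; rewrite (center_mulA xZ).
- move=> x xK x0; have [b bx1] := central_unit_of_simple fixed_ker simpleR xK x0.
  by exists b => //; exact: fixed_kernel_inv bx1.
Qed.
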